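(* Let $x^*\in S$ be a feasible point of (VQFP). Suppose that $h_j$ is convex for each $j\in J$ and that there exist vectors $\tau\in\mathbb{R}^m$, $\lambda\in\mathbb{R}^\ell$ such that $$\sum_{i=1}^m \tau_i \nabla\Big(\frac{f_i}{g_i}\Big)(x^* )+\sum_{j=1}^\ell \lambda_j\nabla h_j(x^* )=0,\qquad \sum_{j=1}^\ell \lambda_j h_j(x^* )=0,\qquad \tau_i>0\ (i\in I),\quad \lambda_j\ge 0\ (j\in J).$$ For $i\in I$ and $k\in K=\{1,\dots,n\}$ define $$\gamma_i^k(x,x^*,\tau)=\frac{\tau_i}{g_i(x^* )}\langle x-x^*,p_i^k\rangle^2,\qquad \eta_i^k(x,x^*,\tau)=\frac{\tau_if_i(x^* )}{[g_i(x^* )]^2}\langle x-x^*,q_i^k\rangle^2 .$$ If for all $x\in S$ $$\mu_k^{A_i}\,\gamma_i^k(x,x^*,\tau)\ \ge\ \mu_k^{B_i}\,\eta_i^k(x,x^*,\tau)\qquad\text{for all } i\in I,\ k\in K,$$ then $x^*$ is a Pareto optimal solution of (VQFP).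
   Context: Setting. Let $m,\ell,n\ge 1$, $I=\{1,\dots,m\}$, $J=\{1,\dots,\ell\}$, and let $\Omega\subseteq\mathbb{R}^n$ be open. For $i\in I$ and $x\in\mathbb{R}^n$ let $f_i(x)=x^TA_ix+a_i^Tx+\bar a_i$ and $g_i(x)=x^TB_ix+b_i^Tx+\bar b_i$, where $A_i,B_i\in\mathbb{R}^{n\times n}$ are symmetric, $B_i$ is positive semidefinite, $a_i,b_i\in\mathbb{R}^n$, $\bar a_i,\bar b_i\in\mathbb{R}$; the system $2B_ix+b_i=0$ is assumed to have a solution $w^i$, and $\bar b_i>-((w^i)^TB_iw^i+b_i^Tw^i)$, so that $g_i(x)>0$ for all $x\in\mathbb{R}^n$. The functions $h_j:\Omega\to\mathbb{R}$, $j\in J$, are continuously differentiable. The feasible set is $S=\{x\in\Omega: h_j(x)\le 0\ \forall j\in J\}$. (VQFP) is the vector problem of minimizing $\big(\frac{f_1(x)}{g_1(x)},\dots,\frac{f_m(x)}{g_m(x)}\big)$ over $x\in S$. A point $x^*\in S$ is a Pareto optimal solution of (VQFP) if there is no $x\in S$ with $\frac{f_i(x)}{g_i(x)}\le\frac{f_i(x^* )}{g_i(x^* )}$ for all $i\in I$ and strict inequality for at least one $i$. Convexity of a differentiable function $h:\Omega\to\mathbb{R}$: $\Omega$ is convex and $h(x)-h(y)\ge\nabla h(y)^T(x-y)$ for all $x,y\in\Omega$. For each $i\in I$, $P_i$ and $Q_i$ are orthogonal matrices whose columns $p_i^1,\dots,p_i^n$ and $q_i^1,\dots,q_i^n$ are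 orthonormal eigenvectors of $A_i$ and $B_i$ respectively; $\mu_k^{A_i}$ and $\mu_k^{B_i}$ are the eigenvalues of $A_i$ and $B_i$ associated with $p_i^k$ and $q_i^k$. $\langle\cdot,\cdot\rangle$ is the usual inner product of $\mathbb{R}^n$. *)

(* Defs.v *)
From mathcomp Require Export all_boot all_order all_algebra.
From mathcomp Require Export all_classical all_reals all_analysis.
Export numFieldNormedType.Exports.

Set Implicit Arguments.
Unset Strict Implicit.
Unset Printing Implicit Defensive.

Import Order.TTheory GRing.Theory Num.Theory.

Local Open Scope classical_set_scope.
Local Open Scope ring_scope.

Section Vectors.
Context {R : realType} {n : nat}.
Implicit Types (x y u v a : 'cV[R]_n) (A P : 'M[R]_n) (Omega : set 'cV[R]_n)
  (h : 'cV[R]_n -> R).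

Definition inner u v : R := \sum_(k < n) u k 0 * v k 0.

Definition quad A a (c : R) x : R := inner x (A *m x) + inner a x + c.

Definition symmetric_mx A : Prop := A^T = A.

Definition psd_mx A : Prop := forall x, 0 <= inner x (A *m x).

(* [P] is orthogonal and its [k]-th column is an eigenvector of [A] for the
   eigenvalue [mu k] (the columns are nonzero because [P] is orthogonal). *)
Definition orthonormal_eigenvectors A P (mu : 'I_n -> R) : Prop :=
  P^T *m P = 1%:M /\ forall k : 'I_n, A *m col k P = mu k *: col k P.

Definition gradient h x : 'cV[R]_n := \col_(k < n) 'D_(delta_mx k 0) h x.

(* For functions on an open set [Omega], represented by total functions whose
   values outside [Omega] are irrelevant. *)
Definition C1_on Omega h : Prop :=
  forall x, Omega x -> differentiable h x /\ {for x, continuous (gradient h)}.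

(* First-order convexity for differentiable [h], not the chord inequality of
   [convex_function]. *)
Definition convex_on Omega h : Prop :=
  convex_set Omega /\
  forall x y, Omega x -> Omega y -> h x - h y >= inner (gradient h y) (x - y).

Definition feasible_set {l : nat} Omega (h : 'I_l -> 'cV[R]_n -> R) :
  set 'cV[R]_n := [set x | Omega x /\ forall j, h j x <= 0].

Definition fractional_objective {m : nat} (f g : 'I_m -> 'cV[R]_n -> R)
  (i : 'I_m) x : R := f i x / g i x.

Definition pareto_optimal {m : nat} (S : set 'cV[R]_n)
    (phi : 'I_m -> 'cV[R]_n -> R) xs : Prop :=
  S xs /\
  ~ (exists x, [/\ S x, (forall i, phi i x <= phi i xs) &
                  exists i, phi i x < phi i xs]).

Definition gamma_coef {m : nat} (g : 'I_m -> 'cV[R]_n -> R)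
    (P : 'I_m -> 'M[R]_n) (i : 'I_m) (k : 'I_n) x xs (tau : 'cV[R]_m) : R :=
  tau i 0 / g i xs * inner (x - xs) (col k (P i)) ^+ 2.

Definition eta_coef {m : nat} (f g : 'I_m -> 'cV[R]_n -> R)
    (Q : 'I_m -> 'M[R]_n) (i : 'I_m) (k : 'I_n) x xs (tau : 'cV[R]_m) : R :=
  tau i 0 * f i xs / g i xs ^+ 2 * inner (x - xs) (col k (Q i)) ^+ 2.

End Vectors.

(* Main.v *)
(* Put d = x - x* and phi = f / g.  Clearing the denominator gives the exact
   identity
     (g x / g x* ) (phi x - phi x* ) = <grad phi(x* ), d>
        + (d^T A d) / g x* - (f x* / (g x* )^2) d^T B d,
   and in the eigenbases the eigenvalue hypothesis makes the last two terms
   contribute nonnegatively after weighting by tau.  Summing over i,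
   stationarity, convexity of the h_j and complementary slackness bound the
   weighted sum of the increments below by 0, whereas a point dominating x*
   would make it negative. *)

Require Import Defs.
From mathcomp Require Import all_boot all_order all_algebra.
From mathcomp Require Import all_classical all_reals all_analysis.
From mathcomp Require Import ring lra.

Import Order.TTheory GRing.Theory Num.Theory.
Import numFieldNormedType.Exports.

Local Open Scope classical_set_scope.
Local Open Scope ring_scope.

Section Quadratic.
Context {R : realType} {n : nat}.
Implicit Types (x y u v d a : 'cV[R]_n) (A B P : 'M[R]_n).

Lemma innerE u v : inner u v = (u^T *m v) 0 0.
Proof. by rewrite mxE; apply: eq_bigr => k _; rewrite mxE. Qed.

Lemma innerC u v : inner u v = inner v u.
Proof. by apply: eq_bigr => k _; rewrite mulrC. Qed.

Lemma innerDl u v x : inner (u + v) x = inner u x + inner v x.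
Proof. by rewrite !innerE linearD /= mulmxDl mxE. Qed.

Lemma innerDr u v x : inner x (u + v) = inner x u + inner x v.
Proof. by rewrite innerC innerDl !(innerC x). Qed.

Lemma innerZl (t : R) u v : inner (t *: u) v = t * inner u v.
Proof. by rewrite !innerE linearZ /= -scalemxAl mxE. Qed.

Lemma innerNl u v : inner (- u) v = - inner u v.
Proof. by rewrite -scaleN1r innerZl mulN1r. Qed.

Lemma innerZr (t : R) u v : inner u (t *: v) = t * inner u v.
Proof. by rewrite innerC innerZl innerC. Qed.

Lemma inner0l u : inner 0 u = 0.
Proof. by rewrite -(scale0r 0) innerZl mul0r. Qed.

Lemma inner_suml {I : finType} (F : I -> 'cV[R]_n) u :
  inner (\sum_i F i) u = \sum_i inner (F i) u.
Proof.
by apply: (big_morph (fun v => inner v u)) => [x y|]; rewrite ?innerDl ?inner0l.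
Qed.

Lemma inner_delta u (k : 'I_n) : inner u (delta_mx k 0) = u k 0.
Proof.
rewrite /inner (bigD1 k) //= mxE !eqxx mulr1 big1 ?addr0 // => j /negPf jk.
by rewrite mxE jk mulr0.
Qed.

Lemma inner_mulmxl A u v : inner (A *m u) v = inner u (A^T *m v).
Proof. by rewrite !innerE trmx_mul mulmxA. Qed.

(** The second-order Taylor expansion is exact in degree two; symmetry of [A] merges the two cross
    terms into the gradient term. *)
Lemma quad_expansion A a c x d : symmetric_mx A ->
  quad A a c (x + d) =
    quad A a c x + inner (2 *: (A *m x) + a) d + inner d (A *m d).
Proof.
move=> symA; rewrite /quad mulmxDr !innerDl !innerDr innerZl.
rewrite inner_mulmxl symA (innerC d (A *m x)) inner_mulmxl symA.
ring.
Qed.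

(** Expanding around the critical point [w] kills the linear term, so [w] is a global minimizer, and
    the bound on [c] makes the minimum positive. *)
Lemma quad_gt0 B b c w x : symmetric_mx B -> psd_mx B ->
  2 *: (B *m w) + b = 0 -> c > - (inner w (B *m w) + inner b w) ->
  0 < quad B b c x.
Proof.
move=> symB psdB w_crit c_gt.
rewrite -[x](subrKC w) quad_expansion // w_crit inner0l addr0.
apply: ltr_wpDr; first exact: psdB.
by rewrite /quad; lra.
Qed.

Lemma inner_spectral A P (mu : 'I_n -> R) d : orthonormal_eigenvectors A P mu ->
  inner d (A *m d) = \sum_k mu k * inner d (col k P) ^+ 2.
Proof.
move=> [PTP AP].
have dE : d = \sum_k inner d (col k P) *: col k P.
  (* [P] is square, so its left inverse is also a right inverse: [d] is [P *m (P^T *m d)], read off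
     column by column. *)
  rewrite -{1}[d]mul1mx -(mulmx1C PTP) -mulmxA.
  apply/colP => i; rewrite mxE summxE; apply: eq_bigr => k _.
  rewrite !mxE mulrC; congr (_ * _).
  by apply: eq_bigr => j _; rewrite !mxE mulrC.
rewrite {2}dE mulmx_sumr innerC inner_suml; apply: eq_bigr => k _.
by rewrite -scalemxAr AP !innerZl (innerC (col k P)); ring.
Qed.

(** By the exact expansion, the difference quotient at [t != 0] is affine in [t]; its constant term
    is the derivative. *)
Lemma is_derive_quad A a c x v : symmetric_mx A ->
  is_derive x v (quad A a c) (inner (2 *: (A *m x) + a) v).
Proof.
move=> symA.
have quotientE : {near 0^', (fun t : R =>
      inner (2 *: (A *m x) + a) v + t * inner v (A *m v)) =1
    (fun t : R => t^-1 *: ((quad A a c \o shift x) (t *: v) - quad A a c x))}.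
  near=> t; have t_neq0 : t != 0 by near: t; exact: nbhs_dnbhs_neq.
  rewrite /= [t *: v + x]addrC quad_expansion // innerZr -scalemxAr innerZr.
  by rewrite innerZl /GRing.scale /=; field.
have cvg_quot : (fun t : R => t^-1 *:
    ((quad A a c \o shift x) (t *: v) - quad A a c x)) @ 0^' -->
    inner (2 *: (A *m x) + a) v.
  apply: cvg_trans (near_eq_cvg quotientE) _.
  (* The limit is written as the affine function at [t = 0], so that the limit rules for sums and
     products apply. *)
  have -> : inner (2 *: (A *m x) + a) v =
      inner (2 *: (A *m x) + a) v + 0 * inner v (A *m v) by rewrite mul0r addr0.
  apply: cvgD; first by rewrite mul0r addr0; exact: cvg_cst.
  by apply: cvgM; [exact: nbhs_dnbhs|exact: cvg_cst].
by apply: DeriveDef; [apply/cvg_ex; eexists; exact: cvg_quot|exact: cvg_lim].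
Unshelve. all: by end_near. Qed.

Lemma gradient_quad_ratio A B a b c c' x : symmetric_mx A -> symmetric_mx B ->
  quad B b c' x != 0 ->
  gradient (fun y => quad A a c y / quad B b c' y) x =
    (quad B b c' x)^-1 *: ((2 *: (A *m x) + a) -
      (quad A a c x / quad B b c' x) *: (2 *: (B *m x) + b)).
Proof.
move=> symA symB g_neq0; apply/colP => k; rewrite mxE.
have df := is_derive_quad A a c x (delta_mx k 0) symA.
have dg := is_derive_quad B b c' x (delta_mx k 0) symB.
have -> : (fun y => quad A a c y / quad B b c' y) =
  quad A a c * (fun y => (quad B b c' y)^-1) by [].
rewrite deriveM; [|exact: ex_derive|exact: derivableV].
rewrite deriveV; [|by []|exact: ex_derive].
rewrite !derive_val.
rewrite !inner_delta /GRing.scale /= !mxE /=.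
by field.
Qed.

(** With f, g the two quadratics, solving their expansions at [y] for the curvature terms cancels
    the gradients, and both sides become (f x - (f y / g y) g x) / g y. *)
Lemma quad_ratio_increment A B a b c c' x y :
  symmetric_mx A -> symmetric_mx B ->
  quad B b c' x != 0 -> quad B b c' y != 0 ->
  quad B b c' x / quad B b c' y *
      (quad A a c x / quad B b c' x - quad A a c y / quad B b c' y) =
    inner (gradient (fun z => quad A a c z / quad B b c' z) y) (x - y) +
    (inner (x - y) (A *m (x - y)) / quad B b c' y -
     quad A a c y / quad B b c' y ^+ 2 * inner (x - y) (B *m (x - y))).
Proof.
move=> symA symB gx gy; rewrite gradient_quad_ratio // innerZl.
rewrite (innerDl (2 *: (A *m y) + a)) innerNl innerZl.
have fx := quad_expansion A a c y (x - y) symA.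
have gxE := quad_expansion B b c' y (x - y) symB.
rewrite subrKC in fx gxE.
have -> : inner (x - y) (A *m (x - y)) =
  quad A a c x - quad A a c y - inner (2 *: (A *m y) + a) (x - y).
  by rewrite fx; ring.
have -> : inner (x - y) (B *m (x - y)) =
  quad B b c' x - quad B b c' y - inner (2 *: (B *m y) + b) (x - y).
  by rewrite gxE; ring.
by field; rewrite gx gy.
Qed.

End Quadratic.

Theorem theorem3p4 (R : realType) (m l n : nat)
  (m_ge1 : (1 <= m)%N) (l_ge1 : (1 <= l)%N) (n_ge1 : (1 <= n)%N)
  (Omega : set 'cV[R]_n) (Omega_open : open Omega)
  (A B : 'I_m -> 'M[R]_n) (a b : 'I_m -> 'cV[R]_n) (abar bbar : 'I_m -> R)
  (A_sym : forall i, symmetric_mx (A i))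
  (B_sym : forall i, symmetric_mx (B i))
  (B_psd : forall i, psd_mx (B i))
  (w : 'I_m -> 'cV[R]_n)
  (w_sol : forall i, 2 *: (B i *m w i) + b i = 0)
  (bbar_gt : forall i,
     bbar i > - (inner (w i) (B i *m w i) + inner (b i) (w i)))
  (f g : 'I_m -> 'cV[R]_n -> R)
  (f_def : forall i x, f i x = quad (A i) (a i) (abar i) x)
  (g_def : forall i x, g i x = quad (B i) (b i) (bbar i) x)
  (h : 'I_l -> 'cV[R]_n -> R)
  (h_C1 : forall j, C1_on Omega (h j))
  (P Q : 'I_m -> 'M[R]_n) (muA muB : 'I_m -> 'I_n -> R)
  (P_eig : forall i, orthonormal_eigenvectors (A i) (P i) (muA i))
  (Q_eig : forall i, orthonormal_eigenvectors (B i) (Q i) (muB i))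
  (xs : 'cV[R]_n) (xs_feas : feasible_set Omega h xs)
  (h_convex : forall j, convex_on Omega (h j)) :
  (exists (tau : 'cV[R]_m) (lambda : 'cV[R]_l),
     [/\ \sum_(i < m) tau i 0 *: gradient (fractional_objective f g i) xs
           + \sum_(j < l) lambda j 0 *: gradient (h j) xs = 0,
         \sum_(j < l) lambda j 0 * h j xs = 0,
         (forall i, 0 < tau i 0),
         (forall j, 0 <= lambda j 0) &
         forall x, feasible_set Omega h x -> forall (i : 'I_m) (k : 'I_n),
           muA i k * gamma_coef g P i k x xs tau
             >= muB i k * eta_coef f g Q i k x xs tau]) ->
  pareto_optimal (feasible_set Omega h) (fractional_objective f g) xs.
Proof.
move=> [tau [lambda [stationary slack tau_gt0 lambda_ge0 curvature]]].
split=> // -[x [x_feas phi_le [i0 phi_lt]]].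
have g_gt0 i y : 0 < g i y.
  by rewrite g_def; exact: (quad_gt0 _ _ _ (w i)).
(* The factor g x / g xs of the increment identity is absorbed into the multiplier; these weights
   depend on [x], but only their positivity matters. *)
pose rho i : R := tau i 0 * (g i x / g i xs).
pose delta i := fractional_objective f g i x - fractional_objective f g i xs.
have rho_gt0 i : 0 < rho i by rewrite mulr_gt0 // divr_gt0.
have increment i : tau i 0 *
    inner (gradient (fractional_objective f g i) xs) (x - xs) <=
    rho i * delta i.
  have -> : fractional_objective f g i =
      (fun z => quad (A i) (a i) (abar i) z / quad (B i) (b i) (bbar i) z).
    by apply/funext => z; rewrite /fractional_objective f_def g_def.
  have gE y : quad (B i) (b i) (bbar i) y != 0 by rewrite -g_def gt_eqF.
  rewrite /rho /delta /fractional_objective !f_def !g_def -mulrA.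
  rewrite quad_ratio_increment // mulrDr lerDl.
  rewrite (inner_spectral (A i) (P i) (muA i)) //.
  rewrite (inner_spectral (B i) (Q i) (muB i)) //.
  (* The two spectral sums live in different eigenbases; they are compared term by term through the
     common index [k]. *)
  rewrite mulrBr subr_ge0 mulr_suml !mulr_sumr ler_sum // => k _.
  have := curvature x x_feas i k.
  rewrite /gamma_coef /eta_coef f_def g_def.
  lra.
have weighted_ge0 : 0 <= \sum_i rho i * delta i.
  apply: le_trans; last by apply: ler_sum => i _; exact: increment.
  have /(congr1 (fun u => inner u (x - xs))) := stationary.
  rewrite innerDl !inner_suml inner0l => /eqP; rewrite addr_eq0 => /eqP.
  under eq_bigr do rewrite innerZl.
  (* Adding the zero sum [slack] turns each term into [lambda j 0] times the linearization of [h j]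
     at [xs], evaluated at [x]; by convexity this linearization is at most [h j x <= 0]. *)
  move=> ->; rewrite oppr_ge0 -[leLHS]addr0 -[X in _ + X]slack -big_split /=.
  rewrite sumr_le0 // => j _; rewrite innerZl -mulrDr mulr_ge0_le0 //.
  have [_ hc] := h_convex j; have [xO hx] := x_feas.
  by have := hc x xs xO xs_feas.1; have := hx j; lra.
have : \sum_i rho i * delta i < 0.
  (* The strictly improved objective [i0] gives a negative term, and all other terms are
     nonpositive. *)
  rewrite (bigD1 i0) //= -[ltRHS]addr0 ltr_leD ?pmulr_rlt0 ?subr_lt0 //.
  by rewrite sumr_le0 // => i _; rewrite pmulr_rle0 // subr_le0.
by rewrite ltNge weighted_ge0.
Qed.
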